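(* Let $\varphi : R \rightarrow S$ be a flat homomorphism of commutative rings and $\mathcal Q$ be any class of $R$-modules. If $M$ is a flat $\mathcal Q$-Mittag-Leffler $R$-module, then $M \otimes_{R} S$ is a flat $(\mathcal Q \otimes_{R} S)$-Mittag-Leffler $S$-module.
   Context: For a commutative ring $T$ and a class $\mathcal E$ of $T$-modules, a $T$-module $N$ is $\mathcal E$-Mittag-Leffler if for every family $(E_i \mid i\in I)$ of elements of $\mathcal E$ the canonical map $N \otimes_T \prod_{i\in I} E_i \to \prod_{i \in I} N\otimes_T E_i$, $x \otimes (e_i)_{i\in I} \mapsto (x\otimes e_i)_{i\in I}$, is injective. For a class $\mathcal Q$ of $R$-modules, $\mathcal Q \otimes_R S$ denotes the class of $S$-modules $\{Q \otimes_R S \mid Q \in \mathcal Q\}$. *)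

(* Defs.v *)
From HB Require Import structures.
From mathcomp Require Import all_boot all_algebra.
From mathcomp Require Import boolp.
From mathcomp.multinomials Require Import freeg.

Set Implicit Arguments.
Unset Strict Implicit.
Unset Printing Implicit Defensive.

Import GRing.Theory.
Local Open Scope quotient_scope.
Local Open Scope ring_scope.

(* tensor M N is the free abelian group on M * N modulo the subgroup          *)
(* generated by the biadditivity and balancing relators.  Its universal       *)
(* property is tensor_liftE, tensor_lift_is_zmod_morphism and tensor_ind. *)

Section Tensor.
Context (R : comPzRingType) (M N : lmodType R).

Inductive tensor_relator : {freeg (M * N)} -> Prop :=
| TensorRelDl m m' n :
    tensor_relator (<< (m + m', n) >> - (<< (m, n) >> + << (m', n) >>))
| TensorRelDr m n n' :
    tensor_relator (<< (m, n + n') >> - (<< (m, n) >> + << (m, n') >>))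
| TensorRelZ (r : R) m n :
    tensor_relator (<< (r *: m, n) >> - << (m, r *: n) >>)
| TensorRel0 : tensor_relator 0
| TensorRelB u v :
    tensor_relator u -> tensor_relator v -> tensor_relator (u - v).

Definition tensor_relators : {pred {freeg (M * N)}} :=
  fun u => `[< tensor_relator u >].

Fact tensor_relators_closed : zmod_closed tensor_relators.
Proof.
split=> [|u v /asboolP ru /asboolP rv]; apply/asboolP.
  exact: TensorRel0.
exact: TensorRelB.
Qed.

HB.instance Definition _ :=
  GRing.isZmodClosed.Build {freeg (M * N)} tensor_relators
    tensor_relators_closed.

Definition tensor := Quotient.quot tensor_relators.

HB.instance Definition _ := GRing.Zmodule.on tensor.

Definition tens (m : M) (n : N) : tensor := \pi_tensor << (m, n) >>.

Definition balanced (V : zmodType) (f : M -> N -> V) :=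
  [/\ forall m m' n, f (m + m') n = f m n + f m' n,
      forall m n n', f m (n + n') = f m n + f m n'
    & forall r m n, f (r *: m) n = f m (r *: n)].

(* The additive map induced by f, meaningful when f is balanced. *)
Definition tensor_lift (V : zmodType) (f : M -> N -> V) (t : tensor) : V :=
  fglift (fun x : M * N => f x.1 x.2 : zmodule V) (repr t).

Lemma pi_tensorP u v :
  tensor_relator (u - v) -> \pi_tensor u = \pi_tensor v.
Proof. by move=> ruv; apply/eqP; rewrite -Quotient.idealrBE; apply/asboolP. Qed.

Lemma tens_balanced : balanced tens.
Proof.
split=> [m m' n|m n n'|r m n].
- by rewrite -[RHS](raddfD (\pi_tensor)); apply/pi_tensorP/TensorRelDl.
- by rewrite -[RHS](raddfD (\pi_tensor)); apply/pi_tensorP/TensorRelDr.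
- exact/pi_tensorP/TensorRelZ.
Qed.

Lemma tensDl m m' n : tens (m + m') n = tens m n + tens m' n.
Proof. by case: tens_balanced. Qed.

Lemma tensDr m n n' : tens m (n + n') = tens m n + tens m n'.
Proof. by case: tens_balanced. Qed.

Lemma tensZ r m n : tens (r *: m) n = tens m (r *: n).
Proof. by case: tens_balanced. Qed.

Lemma tens0l n : tens 0 n = 0.
Proof. by apply: (addrI (tens 0 n)); rewrite -tensDl !addr0. Qed.

Lemma tensNl m n : tens (- m) n = - tens m n.
Proof. by apply/eqP; rewrite -addr_eq0 -tensDl addNr tens0l. Qed.

Lemma tensor_ind (P : tensor -> Prop) :
    P 0 -> (forall t u, P t -> P u -> P (t + u)) ->
    (forall m n, P (tens m n)) ->
  forall t, P t.
Proof.
move=> P0 PD Pt t; rewrite -[t]reprK -[repr t]freeg_sumE raddf_sum /=.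
elim/big_ind: _ => // -[m n] _; move: (coeff _ _) => k.
have Pn p q j : P (tens p q *+ j).
  by elim: j => [|j IHj] //; rewrite mulrS; apply: PD.
rewrite -[X in << X *g _ >>]intz -freegU_mulz raddfMz -/(tens m n).
case: k => k; first exact: Pn.
by rewrite NegzE mulrNz -mulNrz -tensNl; apply: Pn.
Qed.

Section Lift.
Context (V : zmodType) (f : M -> N -> V) (bal_f : balanced f).

Let flift : {freeg (M * N)} -> zmodule V :=
  fglift (fun x : M * N => f x.1 x.2 : zmodule V).

Let fliftB : {morph flift : u v / u - v}.
Proof. exact: lift_is_additive. Qed.

Let fliftU m n : flift << (m, n) >> = f m n.
Proof. by rewrite /flift liftU scale1r. Qed.

Let flift0 : flift 0 = 0. Proof. by rewrite -(subrr 0) fliftB subrr. Qed.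

Let fliftD : {morph flift : u v / u + v}.
Proof.
by move=> u v; rewrite -{1}[v]opprK -(sub0r v) !fliftB flift0 sub0r opprK.
Qed.

Let flift_relator u : tensor_relator u -> flift u = 0.
Proof.
case: bal_f => fDl fDr fZ; elim=> [m m' n|m n n'|r m n||{}u v _ fu _ fv].
- by rewrite fliftB fliftD !fliftU fDl subrr.
- by rewrite fliftB fliftD !fliftU fDr subrr.
- by rewrite fliftB !fliftU fZ subrr.
- exact: flift0.
- by rewrite fliftB fu fv subrr.
Qed.

Let flift_repr u : flift (repr (\pi_tensor u)) = flift u.
Proof.
apply/eqP; rewrite -subr_eq0 -fliftB; apply/eqP/flift_relator/asboolP.
rewrite -[is_true _]/(is_true (_ \in tensor_relators)).
by rewrite Quotient.idealrBE reprK.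
Qed.

Lemma tensor_lift_is_zmod_morphism : zmod_morphism (tensor_lift f).
Proof.
move=> t u; rewrite -[t]reprK -[u]reprK -(raddfB (\pi_tensor)).
by rewrite /tensor_lift -/flift !flift_repr fliftB.
Qed.

Lemma tensor_liftE m n : tensor_lift f (tens m n) = f m n.
Proof. by rewrite /tensor_lift -/flift flift_repr fliftU. Qed.

End Lift.
End Tensor.

Arguments tensor {R} M N.
Arguments tens {R M N} m n.

(* M (x) N is an R-module through r *: (m (x) n) = (r *: m) (x) n. *)
Section TensorModule.
Context (R : comPzRingType) (M N : lmodType R).

Definition tensor_scale (r : R) : tensor M N -> tensor M N :=
  tensor_lift (fun m n => tens (r *: m) n).

Lemma tensor_scale_balanced (r : R) :
  balanced (fun m n => tens (r *: m) n : tensor M N).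
Proof.
split=> [m m' n|m n n'|a m n]; first by rewrite scalerDr tensDl.
  exact: tensDr.
by rewrite -tensZ !scalerA mulrC.
Qed.

Lemma tensor_scaleE r m n : tensor_scale r (tens m n) = tens (r *: m) n.
Proof. exact/tensor_liftE/tensor_scale_balanced. Qed.

Lemma tensor_scaleB r : zmod_morphism (tensor_scale r).
Proof. exact/tensor_lift_is_zmod_morphism/tensor_scale_balanced. Qed.

HB.instance Definition _ r :=
  GRing.isZmodMorphism.Build _ _ (tensor_scale r) (tensor_scaleB r).

Fact tensor_scalerA r s t :
  tensor_scale r (tensor_scale s t) = tensor_scale (r * s) t.
Proof.
elim/tensor_ind: t => [|t u IHt IHu|m n]; first by rewrite !raddf0.
  by rewrite !raddfD /= IHt IHu.
by rewrite !tensor_scaleE scalerA.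
Qed.

Fact tensor_scale1r : left_id 1 tensor_scale.
Proof.
elim/tensor_ind=> [|t u IHt IHu|m n]; first exact: raddf0.
  by rewrite raddfD /= IHt IHu.
by rewrite tensor_scaleE scale1r.
Qed.

Fact tensor_scalerDr : right_distributive tensor_scale +%R.
Proof. by move=> r t u; apply: raddfD. Qed.

Fact tensor_scalerDl t : {morph tensor_scale^~ t : r s / r + s}.
Proof.
move=> r s; elim/tensor_ind: t => [|t u IHt IHu|m n].
- by rewrite !raddf0 addr0.
- by rewrite !raddfD /= IHt IHu addrACA.
- by rewrite !tensor_scaleE scalerDl tensDl.
Qed.

HB.instance Definition _ := GRing.Zmodule_isLmodule.Build R (tensor M N)
  tensor_scalerA tensor_scale1r tensor_scalerDr tensor_scalerDl.

End TensorModule.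

Section TensorMap.
Context (R : comPzRingType) (M A B : lmodType R) (f : {linear A -> B}).

(* The map id_M (x) f. *)
Definition tensor_mapr : tensor M A -> tensor M B :=
  tensor_lift (fun m a => tens m (f a)).

Lemma tensor_mapr_balanced :
  balanced (fun m a => tens m (f a) : tensor M B).
Proof.
split=> [m m' a|m a a'|r m a]; first exact: tensDl.
  by rewrite linearD tensDr.
by rewrite linearZ tensZ.
Qed.

Lemma tensor_maprE m a : tensor_mapr (tens m a) = tens m (f a).
Proof. exact/tensor_liftE/tensor_mapr_balanced. Qed.

End TensorMap.
Arguments tensor_mapr {R} M {A B} f.

(* The S-module N seen as an R-module along phi. *)
Definition restrict (R S : comPzRingType) (phi : {rmorphism R -> S})
    (N : lmodType S) : Type := N.

Section Restriction.
Context (R S : comPzRingType) (phi : {rmorphism R -> S}) (N : lmodType S).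

HB.instance Definition _ := GRing.Zmodule.on (restrict phi N).

Definition restrict_scale (r : R) (n : restrict phi N) : restrict phi N :=
  phi r *: (n : N).

Fact restrict_scalerA r s n :
  restrict_scale r (restrict_scale s n) = restrict_scale (r * s) n.
Proof. by rewrite /restrict_scale scalerA rmorphM. Qed.

Fact restrict_scale1r : left_id 1 restrict_scale.
Proof. by move=> n; rewrite /restrict_scale rmorph1 scale1r. Qed.

Fact restrict_scalerDr : right_distributive restrict_scale +%R.
Proof. by move=> r n n'; apply: scalerDr. Qed.

Fact restrict_scalerDl n : {morph restrict_scale^~ n : r s / r + s}.
Proof. by move=> r s; rewrite /restrict_scale rmorphD scalerDl. Qed.

HB.instance Definition _ := GRing.Zmodule_isLmodule.Build R (restrict phi N)
  restrict_scalerA restrict_scale1r restrict_scalerDr restrict_scalerDl.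

End Restriction.

(* M (x)_R S, an S-module through s *: (m (x) x) = m (x) (s * x). *)
Section BaseChange.
Context (R S : comPzRingType) (phi : {rmorphism R -> S}) (M : lmodType R).

Definition base_change : Type := tensor M (restrict phi S^o).

HB.instance Definition _ := GRing.Zmodule.on base_change.

Definition base_change_scale (s : S) : base_change -> base_change :=
  tensor_lift (fun m (x : restrict phi S^o) =>
    tens m (s * x : restrict phi S^o)).

Lemma base_change_scale_balanced (s : S) :
  balanced (fun (m : M) (x : restrict phi S^o) =>
    tens m (s * x : restrict phi S^o)).
Proof.
split=> [m m' x|m x x'|r m x]; first exact: tensDl.
  by rewrite -tensDr; congr tens; apply: mulrDr.
by rewrite tensZ; congr tens; apply: mulrCA.
Qed.

Lemma base_change_scaleE s (m : M) (x : restrict phi S^o) :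
  base_change_scale s (tens m x) = tens m (s * x : restrict phi S^o).
Proof. exact/(tensor_liftE (base_change_scale_balanced s)). Qed.

Lemma base_change_scaleB s : zmod_morphism (base_change_scale s).
Proof. exact/tensor_lift_is_zmod_morphism/base_change_scale_balanced. Qed.

HB.instance Definition _ s := GRing.isZmodMorphism.Build _ _
  (base_change_scale s) (base_change_scaleB s).

Fact base_change_scalerA r s t :
  base_change_scale r (base_change_scale s t) = base_change_scale (r * s) t.
Proof.
elim/tensor_ind: t => [|t u IHt IHu|m x]; first by rewrite !raddf0.
  by rewrite !raddfD /= IHt IHu.
by rewrite !base_change_scaleE mulrA.
Qed.

Fact base_change_scale1r : left_id 1 base_change_scale.
Proof.
elim/tensor_ind=> [|t u IHt IHu|m x]; first exact: raddf0.
  by rewrite raddfD /= IHt IHu.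
by rewrite base_change_scaleE mul1r.
Qed.

Fact base_change_scalerDr : right_distributive base_change_scale +%R.
Proof. by move=> s t u; apply: raddfD. Qed.

Fact base_change_scalerDl t : {morph base_change_scale^~ t : r s / r + s}.
Proof.
move=> r s; elim/tensor_ind: t => [|t u IHt IHu|m x].
- by rewrite !raddf0 addr0.
- by rewrite !raddfD /= IHt IHu addrACA.
- by rewrite !base_change_scaleE mulrDl -tensDr.
Qed.

HB.instance Definition _ := GRing.Zmodule_isLmodule.Build S base_change
  base_change_scalerA base_change_scale1r base_change_scalerDr
  base_change_scalerDl.

End BaseChange.

Section ModuleProduct.
Context (R : comPzRingType) (I : Type) (E : I -> lmodType R).

Definition mod_prod : Type := forall i, E i.

HB.instance Definition _ := Choice.on mod_prod.

Implicit Types e : mod_prod.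

Lemma mod_prod_ext e e' : (forall i, e i = e' i) -> e = e'.
Proof. exact: functional_extensionality_dep. Qed.

Definition mod_prod_zero : mod_prod := fun=> 0.
Definition mod_prod_opp e : mod_prod := fun i => - e i.
Definition mod_prod_add e e' : mod_prod := fun i => e i + e' i.
Definition mod_prod_scale r e : mod_prod := fun i => r *: e i.

Fact mod_prod_addA : associative mod_prod_add.
Proof. by move=> e e' e''; apply: mod_prod_ext => i; apply: addrA. Qed.

Fact mod_prod_addC : commutative mod_prod_add.
Proof. by move=> e e'; apply: mod_prod_ext => i; apply: addrC. Qed.

Fact mod_prod_add0 : left_id mod_prod_zero mod_prod_add.
Proof. by move=> e; apply: mod_prod_ext => i; apply: add0r. Qed.

Fact mod_prod_addN : left_inverse mod_prod_zero mod_prod_opp mod_prod_add.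
Proof. by move=> e; apply: mod_prod_ext => i; apply: addNr. Qed.

HB.instance Definition _ := GRing.isZmodule.Build mod_prod
  mod_prod_addA mod_prod_addC mod_prod_add0 mod_prod_addN.

Fact mod_prod_scalerA r s e :
  mod_prod_scale r (mod_prod_scale s e) = mod_prod_scale (r * s) e.
Proof. by apply: mod_prod_ext => i; apply: scalerA. Qed.

Fact mod_prod_scale1r : left_id 1 mod_prod_scale.
Proof. by move=> e; apply: mod_prod_ext => i; apply: scale1r. Qed.

Fact mod_prod_scalerDr : right_distributive mod_prod_scale +%R.
Proof. by move=> r e e'; apply: mod_prod_ext => i; apply: scalerDr. Qed.

Fact mod_prod_scalerDl e : {morph mod_prod_scale^~ e : r s / r + s}.
Proof. by move=> r s; apply: mod_prod_ext => i; apply: scalerDl. Qed.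

HB.instance Definition _ := GRing.Zmodule_isLmodule.Build R mod_prod
  mod_prod_scalerA mod_prod_scale1r mod_prod_scalerDr mod_prod_scalerDl.

End ModuleProduct.

Section ProductComparison.
Context (R : comPzRingType) (N : lmodType R) (I : Type) (E : I -> lmodType R).

(* The canonical map sending x (x) (e_i)_i to (x (x) e_i)_i. *)
Definition prod_comparison :
    tensor N (mod_prod E) -> mod_prod (fun i => tensor N (E i) : lmodType R) :=
  tensor_lift (fun (x : N) (e : mod_prod E) =>
    (fun i => tens x (e i)) : mod_prod (fun i => tensor N (E i) : lmodType R)).

Lemma prod_comparison_balanced :
  balanced (fun (x : N) (e : mod_prod E) =>
    (fun i => tens x (e i)) : mod_prod (fun i => tensor N (E i) : lmodType R)).
Proof.
split=> [x x' e|x e e'|r x e]; apply: mod_prod_ext => i.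
- exact: tensDl.
- exact: tensDr.
- exact: tensZ.
Qed.

Lemma prod_comparisonE x (e : mod_prod E) i :
  prod_comparison (tens x e) i = tens x (e i).
Proof. by rewrite /prod_comparison (tensor_liftE prod_comparison_balanced). Qed.

End ProductComparison.
Arguments prod_comparison {R} N {I} E.

Section FlatMittagLeffler.
Context (R : comPzRingType).

Definition exact_at (A B C : zmodType) (f : A -> B) (g : B -> C) :=
  forall b, g b = 0 <-> exists a, f a = b.

(* The functor M (x) - is exact. *)
Definition flat (M : lmodType R) :=
  forall (A B C : lmodType R) (f : {linear A -> B}) (g : {linear B -> C}),
    exact_at f g -> exact_at (tensor_mapr M f) (tensor_mapr M g).

(* Classes of modules are bare predicates: universe constraints forbid       *)
(* set (lmodType R).                                                         *)
Definition mittag_leffler (Q : lmodType R -> Prop) (N : lmodType R) :=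
  forall (I : Type) (E : I -> lmodType R),
    (forall i, Q (E i)) -> injective (prod_comparison N E).

End FlatMittagLeffler.

Definition flat_morphism (R S : comPzRingType) (phi : {rmorphism R -> S}) :=
  flat (restrict phi S^o).

Definition base_change_class (R S : comPzRingType) (phi : {rmorphism R -> S})
    (Q : lmodType R -> Prop) (E : lmodType S) : Prop :=
  exists2 N : lmodType R, Q N & E = base_change phi N.

(* Main.v *)
From HB Require Import structures.
Require Import Defs.
From mathcomp Require Import all_boot all_algebra.
From mathcomp Require Import boolp.

Set Implicit Arguments.
Unset Strict Implicit.
Unset Printing Implicit Defensive.

Import GRing.Theory.
Local Open Scope ring_scope.

(** Both conclusions are read over R, through the natural isomorphism
    (M (x)_R S) (x)_S N = M (x)_R N, where N is an S-module viewed over R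
    ([bc_assoc]). It turns (M (x)_R S) (x)_S - into M (x)_R - composed with
    restriction of scalars, so flatness is inherited at once
    ([flat_base_change]).

    For the Mittag-Leffler property, what has to be carried from the modules N
    in Q to the modules N (x)_R S is a statement about single modules, with no
    products in it. Let x be an element of M (x) F, and let K be the set of all
    a in F that are killed by every f : F -> N with N in Q and
    (M (x) f) x = 0. If M is flat and Q-Mittag-Leffler, then x comes from
    M (x) K ([ml_uniform_support]): choosing for each a outside K a map f_a
    that detects it gives one map F -> prod N_a with kernel K, which
    annihilates x because the comparison map of M is injective, and flatness
    of M places x in the image of M (x) K.

    Now take F = R^n, the vectors m_1, .., m_n in M, and
    x = sum_k m_k (x) delta_k. A map f : R^n -> N is a tuple q in N^n, it
    annihilates x when q lies in the kernel L of N^n -> M (x) N,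
    q |-> sum_k m_k (x) q_k, and it kills a when sum_k a_k q_k = 0. As S is
    flat over R, the corresponding kernel for N (x) S is generated by L, so
    every a in K is also killed by all maps f : R^n -> N (x) S that annihilate
    x ([flat_morphism_annihilator]).

    Finally, an element of M (x) prod E_i, where each E_i is some N (x) S, is
    (M (x) f) x for such an x and some f : R^n -> prod E_i. If all its
    components in M (x) E_i vanish, then every component of f kills K, hence f
    does, and (M (x) f) x = 0 since x comes from M (x) K. *)

(** * Tensor products of modules *)

Section TensorMaps.
Context (R : comPzRingType).
Implicit Types M A B C : lmodType R.

Lemma tensor_mapr_is_zmod_morphism M A B (f : {linear A -> B}) :
  zmod_morphism (tensor_mapr M f).
Proof. exact/tensor_lift_is_zmod_morphism/tensor_mapr_balanced. Qed.

HB.instance Definition _ M A B (f : {linear A -> B}) :=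
  GRing.isZmodMorphism.Build _ _ (tensor_mapr M f)
    (@tensor_mapr_is_zmod_morphism M A B f).

Lemma eq_tensor_mapr M A B (f g : {linear A -> B}) :
  f =1 g -> tensor_mapr M f =1 tensor_mapr M g.
Proof.
move=> fg; elim/tensor_ind => [|t u IHt IHu|m a]; first by rewrite !raddf0.
  by rewrite !raddfD /= IHt IHu.
by rewrite !tensor_maprE fg.
Qed.

Lemma tensor_mapr_comp M A B C (f : {linear A -> B}) (g : {linear B -> C}) t :
  tensor_mapr M g (tensor_mapr M f t) = tensor_mapr M (g \o f) t.
Proof.
elim/tensor_ind: t => [|t u IHt IHu|m a]; first by rewrite !raddf0.
  by rewrite !raddfD /= IHt IHu.
by rewrite !tensor_maprE.
Qed.

Lemma tensor_mapr_eq0 M A B (f : {linear A -> B}) t :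
  (forall a, f a = 0) -> tensor_mapr M f t = 0.
Proof.
move=> f0; elim/tensor_ind: t => [|t u IHt IHu|m a]; first by rewrite raddf0.
  by rewrite raddfD /= IHt IHu addr0.
by rewrite tensor_maprE f0 -(scale0r 0) -tensZ scale0r tens0l.
Qed.

Lemma tens_is_linear M A (m : M) : linear (tens m : A -> tensor M A).
Proof. by move=> r a b; rewrite tensDr -tensZ -tensor_scaleE. Qed.

HB.instance Definition _ M A (m : M) :=
  GRing.isLinear.Build R A (tensor M A) _ (tens m) (tens_is_linear m).

Lemma tensor_finite_sum M A (t : tensor M A) :
  exists n (m : 'I_n -> M) (a : 'I_n -> A), t = \sum_k tens (m k) (a k).
Proof.
have [s ->] : exists s : seq (M * A), t = \sum_(p <- s) tens p.1 p.2.
  elim/tensor_ind: t => [|t u [s ->] [s' ->]|m a].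
  - by exists [::]; rewrite big_nil.
  - by exists (s ++ s'); rewrite big_cat.
  - by exists [:: (m, a)]; rewrite big_seq1.
exists (size s), (fun k => (tnth (in_tuple s) k).1).
by exists (fun k => (tnth (in_tuple s) k).2); rewrite big_tnth.
Qed.

Lemma prod_comparison_is_zmod_morphism M (I : Type) (E : I -> lmodType R) :
  zmod_morphism (prod_comparison M E).
Proof. exact/tensor_lift_is_zmod_morphism/prod_comparison_balanced. Qed.

HB.instance Definition _ M (I : Type) (E : I -> lmodType R) :=
  GRing.isZmodMorphism.Build _ _ (prod_comparison M E)
    (@prod_comparison_is_zmod_morphism M I E).

Definition tensor_swap M A : tensor M A -> tensor A M :=
  tensor_lift (fun m a => tens a m).

Lemma tensor_swap_balanced M A :
  balanced (fun (m : M) (a : A) => tens a m : tensor A M).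
Proof.
split=> [m m' a|m a a'|r m a]; first exact: tensDr.
  exact: tensDl.
by rewrite tensZ.
Qed.

Lemma tensor_swapE M A (m : M) (a : A) : tensor_swap (tens m a) = tens a m.
Proof. exact/tensor_liftE/tensor_swap_balanced. Qed.

Lemma tensor_swap_is_zmod_morphism M A : zmod_morphism (@tensor_swap M A).
Proof. exact/tensor_lift_is_zmod_morphism/tensor_swap_balanced. Qed.

HB.instance Definition _ M A :=
  GRing.isZmodMorphism.Build _ _ (@tensor_swap M A)
    (@tensor_swap_is_zmod_morphism M A).

Lemma tensor_swapK M A : cancel (@tensor_swap M A) (@tensor_swap A M).
Proof.
elim/tensor_ind => [|t u IHt IHu|m a]; first by rewrite !raddf0.
  by rewrite !raddfD /= IHt IHu.
by rewrite !tensor_swapE.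
Qed.

End TensorMaps.

(** * Kernels and products of modules *)

Section Kernel.
Context (R : comPzRingType) (A B : lmodType R) (f : {linear A -> B}).

Definition lin_kernel_pred : {pred A} := fun a => f a == 0.

Fact lin_kernel_closed : subsemimod_closed lin_kernel_pred.
Proof.
split; first split; rewrite ?unfold_in /lin_kernel_pred ?linear0 //.
  move=> a b; rewrite !unfold_in => /eqP fa /eqP fb.
  by rewrite linearD fa fb addr0.
by move=> r a; rewrite !unfold_in => /eqP fa; rewrite linearZ /= fa scaler0.
Qed.

HB.instance Definition _ :=
  GRing.isSubmodClosed.Build R A lin_kernel_pred lin_kernel_closed.

Record lin_kernel := LinKernel {
  lin_kernel_val :> A; _ : lin_kernel_val \in lin_kernel_pred }.

HB.instance Definition _ := [isSub for lin_kernel_val].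
HB.instance Definition _ := [Choice of lin_kernel by <:].
HB.instance Definition _ := [SubChoice_isSubLmodule of lin_kernel by <:].

Definition lin_kernel_incl : {linear lin_kernel -> A} :=
  (val : lin_kernel -> A).

Lemma lin_kernel_exact : exact_at lin_kernel_incl f.
Proof.
move=> a; split=> [fa0|[x <-]]; last by case: x => b fb; apply/eqP.
have ka : a \in lin_kernel_pred by apply/eqP.
by exists (LinKernel ka).
Qed.

End Kernel.

Section Products.
Context (R : comPzRingType) (I : Type) (E : I -> lmodType R).

Definition prod_proj (i : I) (e : mod_prod E) : E i := e i.

Fact prod_proj_is_linear i : linear (prod_proj i).
Proof. by []. Qed.

HB.instance Definition _ i :=
  GRing.isLinear.Build R (mod_prod E) (E i) _ (prod_proj i)
    (prod_proj_is_linear i).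

Lemma prod_comparison_proj (N : lmodType R) t i :
  prod_comparison N E t i = tensor_mapr N (prod_proj i) t.
Proof.
elim/tensor_ind: t => [|t u IHt IHu|m e]; first by rewrite !raddf0.
  by rewrite !raddfD /= -IHt -IHu.
by rewrite prod_comparisonE tensor_maprE.
Qed.

Definition prod_pairing (F : lmodType R) (f : forall i, {linear F -> E i})
  (a : F) : mod_prod E := fun i => f i a.

Fact prod_pairing_is_linear (F : lmodType R) (f : forall i, {linear F -> E i}) :
  linear (prod_pairing f).
Proof. by move=> r a b; apply: mod_prod_ext => i; apply: linearP. Qed.

HB.instance Definition _ (F : lmodType R) (f : forall i, {linear F -> E i}) :=
  GRing.isLinear.Build R F (mod_prod E) _ (prod_pairing f)
    (prod_pairing_is_linear f).

End Products.

(** Flatness alone gives, for each f with (M (x) f) x = 0, a support of x that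
    depends on f, namely ker f. The Mittag-Leffler property makes the support
    uniform, since countermodels for all candidates fit in one product. For
    F = R^n, this says that a single factorization of (m_1, .., m_n) in M
    witnesses, by the equational criterion for flatness, all relations
    sum_k m_k (x) q_k = 0 with the q_k in a module of Q. *)
Lemma ml_uniform_support (R : comPzRingType) (Q : lmodType R -> Prop)
    (M F : lmodType R) (x : tensor M F) :
  flat M -> mittag_leffler Q M ->
  exists (K : lmodType R) (j : {linear K -> F}),
    (exists y, tensor_mapr M j y = x) /\
    (forall (N : lmodType R) (f : {linear F -> N}),
       Q N -> tensor_mapr M f x = 0 -> forall a, f (j a) = 0).
Proof.
move=> flatM mlM.
pose bad (a : F) (w : {N : lmodType R & {linear F -> N}}) :=
  [/\ Q (tag w), tensor_mapr M (tagged w) x = 0 & tagged w a <> 0].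
(* The product has one factor for each element of F to be excluded, because Q
   may be a proper class, over which no product can be taken. *)
have [w wP] := choice (fun i : {a | exists w, bad a w} => svalP i).
pose E i := tag (w i); pose f i : {linear F -> E i} := tagged (w i).
pose g : {linear F -> mod_prod E} := prod_pairing f.
have QE i : Q (E i) by case: (wP i).
exists (lin_kernel g), (lin_kernel_incl g); split.
  apply/(flatM _ _ _ _ _ (lin_kernel_exact g)).
  apply: (mlM _ _ QE); apply: mod_prod_ext => i.
  rewrite prod_comparison_proj tensor_mapr_comp raddf0.
  by rewrite (eq_tensor_mapr (g := f i)) //; case: (wP i).
move=> N h QN hx a; apply: contrapT => ha0.
have bad_a : exists w, bad (lin_kernel_incl g a) w.
  by exists (existT (fun N : lmodType R => {linear F -> N}) N h).
have /(congr1 (@prod_proj _ _ E (exist _ _ bad_a))) :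
    g (lin_kernel_incl g a) = 0.
  by apply/lin_kernel_exact; exists a.
by case: (wP (exist _ _ bad_a)).
Qed.

(** * Finite tuples of vectors *)

Section Tuples.
Context (R : comPzRingType) (n : nat) (A : lmodType R).
Implicit Types (q : 'I_n -> A) (a : 'rV[R]_n).

Definition lincomb q a : A := \sum_k a 0 k *: q k.

Fact lincomb_is_linear q : linear (lincomb q).
Proof.
move=> r a b; rewrite scaler_sumr -big_split; apply: eq_bigr => k _.
by rewrite !mxE scalerDl scalerA.
Qed.

HB.instance Definition _ q :=
  GRing.isLinear.Build R 'rV[R]_n A _ (lincomb q) (lincomb_is_linear q).

Lemma lincomb_delta q k : lincomb q (delta_mx 0 k) = q k.
Proof.
rewrite /lincomb (bigD1 k) //= mxE !eqxx scale1r big1 ?addr0 // => l lk.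
by rewrite mxE (negPf lk) andbF scale0r.
Qed.

Lemma lincombE (f : {linear 'rV[R]_n -> A}) a :
  f a = lincomb (fun k => f (delta_mx 0 k)) a.
Proof.
rewrite {1}[a]row_sum_delta linear_sum.
by apply: eq_bigr => k _; rewrite linearZ.
Qed.

Definition tuple_comb a (q : {ffun 'I_n -> A}) : A := lincomb q a.

Fact tuple_comb_is_linear a : linear (tuple_comb a).
Proof.
move=> r q q'; rewrite scaler_sumr -big_split; apply: eq_bigr => k _.
by rewrite !ffunE scalerDr !scalerA mulrC.
Qed.

HB.instance Definition _ a :=
  GRing.isLinear.Build R {ffun 'I_n -> A} A _ (tuple_comb a)
    (tuple_comb_is_linear a).

Definition tuple_tens (M : lmodType R) (m : 'I_n -> M)
  (q : {ffun 'I_n -> A}) : tensor M A := \sum_k tens (m k) (q k).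

Fact tuple_tens_is_linear (M : lmodType R) (m : 'I_n -> M) :
  linear (tuple_tens m).
Proof.
move=> r q q'; rewrite scaler_sumr -big_split; apply: eq_bigr => k _.
by rewrite !ffunE linearP.
Qed.

HB.instance Definition _ (M : lmodType R) (m : 'I_n -> M) :=
  GRing.isLinear.Build R {ffun 'I_n -> A} (tensor M A) _ (tuple_tens m)
    (tuple_tens_is_linear m).

Definition tuple_single (k : 'I_n) (v : A) : {ffun 'I_n -> A} :=
  [ffun l => if l == k then v else 0].

Fact tuple_single_is_linear k : linear (tuple_single k).
Proof.
move=> r v v'; apply/ffunP => l; rewrite !ffunE.
by case: eqP => // _; rewrite scaler0 addr0.
Qed.

HB.instance Definition _ k :=
  GRing.isLinear.Build R A {ffun 'I_n -> A} _ (tuple_single k)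
    (tuple_single_is_linear k).

Lemma tuple_comb_single a k v : tuple_comb a (tuple_single k v) = a 0 k *: v.
Proof.
rewrite /tuple_comb /lincomb (bigD1 k) //= ffunE eqxx big1 ?addr0 // => l lk.
by rewrite ffunE (negPf lk) scaler0.
Qed.

Lemma tuple_tens_single (M : lmodType R) (m : 'I_n -> M) k v :
  tuple_tens m (tuple_single k v) = tens (m k) v.
Proof.
rewrite /tuple_tens (bigD1 k) //= ffunE eqxx big1 ?addr0 // => l lk.
by rewrite ffunE (negPf lk) linear0.
Qed.

(** Every element of M (x) A is the image of one of these under a linear map
    R^n -> A, R^n being free. *)
Definition generic_tensor (M : lmodType R) (m : 'I_n -> M) :
  tensor M 'rV[R]_n := \sum_k tens (m k) (delta_mx 0 k).

Lemma tensor_mapr_generic (M : lmodType R) (m : 'I_n -> M)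
    (f : {linear 'rV[R]_n -> A}) :
  tensor_mapr M f (generic_tensor m) = \sum_k tens (m k) (f (delta_mx 0 k)).
Proof. by rewrite raddf_sum; apply: eq_bigr => k _; rewrite /= tensor_maprE. Qed.

End Tuples.

(** * Base change *)

Section BaseChangeTheory.
Context (R S : comPzRingType) (phi : {rmorphism R -> S}).

Section RestrictMap.
Context (A B : lmodType S) (f : {linear A -> B}).

Definition restrict_map (a : restrict phi A) : restrict phi B := f a.

Fact restrict_map_is_linear : linear restrict_map.
Proof. by move=> r a b; rewrite /restrict_map [LHS]linearP. Qed.

HB.instance Definition _ :=
  GRing.isLinear.Build R (restrict phi A) (restrict phi B) _ restrict_map
    restrict_map_is_linear.

End RestrictMap.

Section Associativity.
Context (M : lmodType R) (N : lmodType S).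

Definition bc_action (n : N) : base_change phi M -> tensor M (restrict phi N) :=
  tensor_lift (fun m (s : restrict phi S^o) =>
    tens m ((s : S) *: n : restrict phi N)).

Lemma bc_action_balanced (n : N) :
  balanced (fun (m : M) (s : restrict phi S^o) =>
    tens m ((s : S) *: n : restrict phi N)).
Proof.
split=> [m m' s|m s s'|r m s]; first exact: tensDl.
  by rewrite -tensDr; congr tens; exact: (scalerDl n (s : S) s').
by rewrite tensZ; congr tens; rewrite -[RHS]scalerA.
Qed.

Lemma bc_actionE n m (s : restrict phi S^o) :
  bc_action n (tens m s) = tens m ((s : S) *: n : restrict phi N).
Proof. exact/(tensor_liftE (bc_action_balanced n)). Qed.

Lemma bc_action_is_zmod_morphism n : zmod_morphism (bc_action n).
Proof. exact/tensor_lift_is_zmod_morphism/bc_action_balanced. Qed.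

HB.instance Definition _ n :=
  GRing.isZmodMorphism.Build (base_change phi M) (tensor M (restrict phi N))
    (bc_action n) (bc_action_is_zmod_morphism n).

Definition bc_assoc :
    tensor (base_change phi M) N -> tensor M (restrict phi N) :=
  tensor_lift (fun t n => bc_action n t).

Lemma bc_assoc_balanced :
  balanced (fun (t : base_change phi M) (n : N) => bc_action n t).
Proof.
split=> [t u n|t n n'|s t n]; first exact: raddfD.
- elim/tensor_ind: t => [|t u IHt IHu|m s]; first by rewrite !raddf0 addr0.
    by rewrite !raddfD /= IHt IHu addrACA.
  by rewrite !bc_actionE -tensDr; congr tens; exact: (scalerDr (s : S) n n').
- elim/tensor_ind: t => [|t u IHt IHu|m s']; first by rewrite !raddf0.
    by rewrite !raddfD /= IHt IHu.
  rewrite [s *: _]base_change_scaleE !bc_actionE; congr tens.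
  by rewrite scalerA mulrC.
Qed.

Lemma bc_assocE t n : bc_assoc (tens t n) = bc_action n t.
Proof. exact/(tensor_liftE bc_assoc_balanced). Qed.

Lemma bc_assoc_is_zmod_morphism : zmod_morphism bc_assoc.
Proof. exact/tensor_lift_is_zmod_morphism/bc_assoc_balanced. Qed.

HB.instance Definition _ := GRing.isZmodMorphism.Build
  (tensor (base_change phi M) N) (tensor M (restrict phi N)) bc_assoc
  bc_assoc_is_zmod_morphism.

Definition bc_unassoc :
    tensor M (restrict phi N) -> tensor (base_change phi M) N :=
  tensor_lift (fun m (n : restrict phi N) =>
    tens (tens m (1 : restrict phi S^o) : base_change phi M) (n : N)).

Lemma bc_unassoc_balanced :
  balanced (fun (m : M) (n : restrict phi N) =>
    tens (tens m (1 : restrict phi S^o) : base_change phi M) (n : N)).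
Proof.
split=> [m m' n|m n n'|r m n].
- by rewrite -tensDl; congr tens; apply: tensDl.
- exact: tensDr.
- rewrite -[r *: n]/(phi r *: (n : N)) -tensZ [phi r *: _]base_change_scaleE.
  by rewrite tensZ.
Qed.

Lemma bc_unassocE m (n : restrict phi N) :
  bc_unassoc (tens m n) =
  tens (tens m (1 : restrict phi S^o) : base_change phi M) (n : N).
Proof. exact/(tensor_liftE bc_unassoc_balanced). Qed.

Lemma bc_unassoc_is_zmod_morphism : zmod_morphism bc_unassoc.
Proof. exact/tensor_lift_is_zmod_morphism/bc_unassoc_balanced. Qed.

HB.instance Definition _ := GRing.isZmodMorphism.Build
  (tensor M (restrict phi N)) (tensor (base_change phi M) N) bc_unassoc
  bc_unassoc_is_zmod_morphism.

Lemma bc_assocK : cancel bc_assoc bc_unassoc.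
Proof.
elim/tensor_ind=> [|t u IHt IHu|t n]; first by rewrite !raddf0.
  by rewrite !raddfD /= IHt IHu.
rewrite bc_assocE; elim/tensor_ind: t => [|t u IHt IHu|m s].
- by rewrite !raddf0 tens0l.
- by rewrite !raddfD /= IHt IHu -tensDl.
- rewrite bc_actionE bc_unassocE -tensZ [s *: _]base_change_scaleE.
  by congr tens; rewrite -[RHS]/(tens m s); congr tens; apply: mulr1.
Qed.

End Associativity.

Lemma bc_assoc_natural (M : lmodType R) (A B : lmodType S)
    (f : {linear A -> B}) t :
  bc_assoc (tensor_mapr (base_change phi M) f t) =
  tensor_mapr M (restrict_map f) (bc_assoc t).
Proof.
elim/tensor_ind: t => [|t u IHt IHu|t a]; first by rewrite !raddf0.
  by rewrite !raddfD /= IHt IHu.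
rewrite tensor_maprE !bc_assocE.
elim/tensor_ind: t => [|t u IHt IHu|m s]; first by rewrite !raddf0.
  by rewrite !raddfD /= IHt IHu.
by rewrite !bc_actionE tensor_maprE; congr tens; rewrite -[LHS]linearZ.
Qed.

Lemma bc_unassoc_natural (M : lmodType R) (A B : lmodType S)
    (f : {linear A -> B}) t :
  bc_unassoc (tensor_mapr M (restrict_map f) t) =
  tensor_mapr (base_change phi M) f (bc_unassoc t).
Proof.
elim/tensor_ind: t => [|t u IHt IHu|m a]; first by rewrite !raddf0.
  by rewrite !raddfD /= IHt IHu.
by rewrite tensor_maprE !bc_unassocE tensor_maprE.
Qed.

Lemma flat_base_change (M : lmodType R) : flat M -> flat (base_change phi M).
Proof.
move=> flatM A B C f g fg t.
have /flatM exM : exact_at (restrict_map f) (restrict_map g) by [].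
split=> [gt0|[u ut]].
  have /exM[u ut] : tensor_mapr M (restrict_map g) (bc_assoc t) = 0.
    by rewrite -bc_assoc_natural gt0 raddf0.
  by exists (bc_unassoc u); rewrite -bc_unassoc_natural ut bc_assocK.
apply: (can_inj (@bc_assocK M C)); rewrite raddf0 bc_assoc_natural.
by apply/exM; exists (bc_assoc u); rewrite -bc_assoc_natural ut.
Qed.

Section Exchange.
Context (M A : lmodType R).

(** The map m (x) (a (x) s) |-> s (x) (m (x) a). The factor S has to move to
    the left because flatness of phi is the exactness of S (x) -. *)
Definition bc_exchange : tensor M (restrict phi (base_change phi A)) ->
    tensor (restrict phi S^o) (tensor M A) :=
  tensor_lift (fun (m : M) (t : restrict phi (base_change phi A)) =>
    tensor_mapr (restrict phi S^o) (tens m : {linear A -> tensor M A})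
      (tensor_swap t)).

Lemma bc_exchange_balanced :
  balanced (fun (m : M) (t : restrict phi (base_change phi A)) =>
    tensor_mapr (restrict phi S^o) (tens m : {linear A -> tensor M A})
      (tensor_swap t)).
Proof.
split=> [m m' t|m t t'|r m t]; last 1 first.
- rewrite -[r *: t]/(phi r *: (t : base_change phi A)).
  elim/tensor_ind: t => [|t u IHt IHu|q s]; first by rewrite !raddf0.
    by rewrite !raddfD /= IHt IHu.
  rewrite [phi r *: _]base_change_scaleE !tensor_swapE !tensor_maprE.
  by rewrite /= -(tensor_scaleE r m q); apply: esym; apply: tensZ.
- elim/tensor_ind: t => [|t u IHt IHu|q s]; first by rewrite !raddf0 addr0.
    by rewrite !raddfD /= IHt IHu addrACA.
  by rewrite tensor_swapE !tensor_maprE /= tensDl tensDr.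
- by rewrite -!raddfD.
Qed.

Lemma bc_exchangeE m (t : restrict phi (base_change phi A)) :
  bc_exchange (tens m t) =
  tensor_mapr (restrict phi S^o) (tens m : {linear A -> tensor M A})
    (tensor_swap t).
Proof. exact/(tensor_liftE bc_exchange_balanced). Qed.

Lemma bc_exchange_is_zmod_morphism : zmod_morphism bc_exchange.
Proof. exact/tensor_lift_is_zmod_morphism/bc_exchange_balanced. Qed.

HB.instance Definition _ := GRing.isZmodMorphism.Build
  (tensor M (restrict phi (base_change phi A)))
  (tensor (restrict phi S^o) (tensor M A)) bc_exchange
  bc_exchange_is_zmod_morphism.

End Exchange.

(** A map from R^n to A (x) S that annihilates the generic tensor is a tuple in
    (A (x) S)^n, that is, an element w of S (x) A^n, whose image in
    S (x) (M (x) A) vanishes. By flatness of S, w comes from S (x) L with L the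
    kernel of A^n -> M (x) A. The elements of L are the maps R^n -> A that
    annihilate the generic tensor; as these kill a, so does the tuple w. *)
Lemma flat_morphism_annihilator (M A : lmodType R) n (m : 'I_n -> M)
    (a : 'rV[R]_n) :
  flat_morphism phi ->
  (forall f : {linear 'rV[R]_n -> A},
     tensor_mapr M f (generic_tensor m) = 0 -> f a = 0) ->
  forall f : {linear 'rV[R]_n -> restrict phi (base_change phi A)},
    tensor_mapr M f (generic_tensor m) = 0 -> f a = 0.
Proof.
move=> flat_phi killA f fm0; pose T := restrict phi S^o.
pose e k : tensor A T := f (delta_mx 0 k).
pose w := \sum_k tensor_mapr T (tuple_single k) (tensor_swap (e k)).
have /(flat_phi _ _ _ _ _ (lin_kernel_exact (tuple_tens m)))[z zw] :
    tensor_mapr T (tuple_tens m) w = 0.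
  have /(congr1 (@bc_exchange M A)) := fm0.
  rewrite tensor_mapr_generic raddf_sum raddf0 => <-.
  rewrite raddf_sum; apply: eq_bigr => k _.
  rewrite /= bc_exchangeE tensor_mapr_comp; apply: eq_tensor_mapr => v /=.
  exact: tuple_tens_single.
have w0 : tensor_mapr T (tuple_comb a) w = 0.
  rewrite -zw tensor_mapr_comp; apply: tensor_mapr_eq0 => q /=.
  apply: (killA (lincomb (val q))); rewrite tensor_mapr_generic.
  under eq_bigr => k _ do rewrite /= lincomb_delta.
  by apply/(lin_kernel_exact (tuple_tens m)); exists q.
apply: (can_inj (@tensor_swapK R A T)); rewrite raddf0 -w0.
(* It remains to see that pairing w with a gives f a up to the swap; both
   sides are sums over k, compared on pure tensors. *)
rewrite lincombE !raddf_sum; apply: eq_bigr => k _.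
rewrite /= -/(e k) tensor_mapr_comp.
rewrite -[a 0 k *: _]/(phi (a 0 k) *: (e k : base_change phi A)).
elim/tensor_ind: (e k) => [|t u IHt IHu|q s]; first by rewrite !raddf0.
  by rewrite !raddfD /= IHt IHu.
rewrite [phi _ *: _]base_change_scaleE !tensor_swapE tensor_maprE /=.
by rewrite tuple_comb_single -tensZ.
Qed.

End BaseChangeTheory.

Theorem lemma3p5 (R S : comPzRingType) (phi : {rmorphism R -> S})
    (Q : lmodType R -> Prop) (M : lmodType R) :
  flat_morphism phi -> flat M -> mittag_leffler Q M ->
  flat (base_change phi M) /\
  mittag_leffler (base_change_class phi Q) (base_change phi M).
Proof.
move=> flat_phi flatM mlM; split; first exact: flat_base_change.
move=> I E QE t u tu; apply/eqP; rewrite -subr_eq0; apply/eqP.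
have {tu} : prod_comparison (base_change phi M) E (t - u) = 0.
  by rewrite raddfB /= tu subrr.
move: (t - u) => {u}t t0; apply: (can_inj (@bc_assocK _ _ phi M _)).
rewrite raddf0; have [n [m [e te]]] := tensor_finite_sum (bc_assoc t).
have [K [j [[y yx] kill]]] :=
  ml_uniform_support (generic_tensor m) flatM mlM.
(* The vectors e k of the product are viewed over R, so that t becomes the
   image of a generic tensor under one R-linear map f. *)
pose P := restrict phi (mod_prod E).
pose f : {linear 'rV[R]_n -> P} := lincomb (e : 'I_n -> P).
have ft : bc_assoc t = tensor_mapr M f (generic_tensor m).
  rewrite te tensor_mapr_generic; apply: eq_bigr => k _.
  by rewrite /= lincomb_delta.
rewrite ft -yx tensor_mapr_comp; apply: tensor_mapr_eq0 => a /=.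
apply: (@mod_prod_ext S I E) => i.
pose fi : {linear 'rV[R]_n -> restrict phi (E i)} :=
  restrict_map (@prod_proj S I E i) \o f.
have fi0 : tensor_mapr M fi (generic_tensor m) = 0.
  rewrite -tensor_mapr_comp -ft -bc_assoc_natural -prod_comparison_proj t0.
  exact: raddf0.
suff: fi (j a) = 0 by [].
case: (QE i) fi fi0 => N QN -> fi fi0.
by apply: flat_morphism_annihilator fi0 => // h hm; apply: kill.
Qed.
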